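(* Let $\alpha\in[0,1]$, $q>\alpha+\frac74$ and $s>\frac{1}{\alpha+1}$. Then for every $\tau>0$ the problem $$\partial_t\theta+u\cdot\nabla\theta=0,\qquad u=(-\Delta)^{\alpha/2}\mathbf{M}\theta,\qquad \theta(\mathbf{x},0)=\theta_0(\mathbf{x})$$ on $\mathbb{T}^3\times(0,\infty)$ is locally Lipschitz $(H^q,G^s_\tau)$ ill-posed, i.e. not locally Lipschitz $(H^q,G^s_\tau)$ well-posed.
   Context: $\mathbb{T}^3=[0,2\pi]^3$ periodic; functions mean-free. $\mathbf{M}$ is the Fourier multiplier with symbols, for $k_3\ne0$: $\widehat{\mathbf{M}}_1(\mathbf{k})=\frac{2\Omega k_2k_3|\mathbf{k}|^2-(\beta^2/\eta)k_1k_2^2k_3}{4\Omega^2k_3^2|\mathbf{k}|^2+(\beta^2/\eta)^2k_2^4}$, $\widehat{\mathbf{M}}_2(\mathbf{k})=\frac{-2\Omega k_1k_3|\mathbf{k}|^2-(\beta^2/\eta)k_2^3k_3}{4\Omega^2k_3^2|\mathbf{k}|^2+(\beta^2/\eta)^2k_2^4}$, $\widehat{\mathbf{M}}_3(\mathbf{k})=\frac{(\beta^2/\eta)k_2^2(k_1^2+k_2^2)}{4\Omega^2k_3^2|\mathbf{k}|^2+(\beta^2/\eta)^2k_2^4}$, and $\widehat{\mathbf{M}}(k_1,k_2,0)=0$, with fixed constants $\beta,\eta,\Omega>0$; $(-\Delta)^{\alpha/2}$ has symbol $|\mathbf{k}|^\alpha$, so $(-\Delta)^{\alpha/2}\mathbf{M}$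 is singular of order $r_0=\alpha+1$. For fixed $r>3$: $\|\theta\|_{G^s_\tau}^2=\sum_{\mathbf{k}\ne0}|\mathbf{k}|^{2r}e^{2\tau|\mathbf{k}|^{1/s}}|\widehat\theta(\mathbf{k})|^2$. Definition: for Banach spaces $Y\subset X\subset H^q$ (with $q>r_0+\frac d4$, here $d=3$), the problem is locally Lipschitz $(X,Y)$ well-posed if there exist continuous $T,K:[0,\infty)^2\to(0,\infty)$ such that for all initial data $\theta_0^{(1)},\theta_0^{(2)}\in Y$ there are unique solutions $\theta^{(1)},\theta^{(2)}\in L^\infty(0,T;X)$ with $\|\theta^{(1)}(t)-\theta^{(2)}(t)\|_X\le K\|\theta_0^{(1)}-\theta_0^{(2)}\|_Y$ for all $t\in[0,T]$, where $T,K$ are evaluated at $(\|\theta_0^{(1)}\|_Y,\|\theta_0^{(2)}\|_Y)$. *)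

(* Defs.v *)
From HB Require Import structures.
From mathcomp Require Import all_boot all_order all_algebra.
From mathcomp Require Import all_classical all_reals all_analysis.
From mathcomp Require Import complex.
Set Implicit Arguments. Unset Strict Implicit. Unset Printing Implicit Defensive.
Import Order.TTheory GRing.Theory Num.Theory.
Import numFieldNormedType.Exports.
Local Open Scope classical_set_scope.
Local Open Scope ring_scope.

(* Everything is done on the Fourier side: a (real-valued, mean-free)
   function on T^3 = [0,2pi]^3 is represented by its Fourier coefficients
   theta : Z^3 -> C, with theta(0) = 0 (mean-free) and
   theta(-k) = conj(theta(k)) (real-valued). *)

Definition Z3 := (int * int * int)%type.

Section Defs.
Variable R : realType.

Definition k1 (k : Z3) : R := (k.1.1)%:~R.
Definition k2 (k : Z3) : R := (k.1.2)%:~R.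
Definition k3 (k : Z3) : R := (k.2)%:~R.

Definition zneg (k : Z3) : Z3 := (- k.1.1, - k.1.2, - k.2)%R.
Definition zsub (k l : Z3) : Z3 := (k.1.1 - l.1.1, k.1.2 - l.1.2, k.2 - l.2)%R.

Definition knorm2 (k : Z3) : R := k1 k ^+ 2 + k2 k ^+ 2 + k3 k ^+ 2.
Definition knorm (k : Z3) : R := Num.sqrt (knorm2 k).

Definition Mden (Om be et : R) (k : Z3) : R :=
  4 * Om ^+ 2 * k3 k ^+ 2 * knorm2 k + (be ^+ 2 / et) ^+ 2 * k2 k ^+ 4.
Definition M1 (Om be et : R) (k : Z3) : R :=
  if k.2 == 0%R then 0 else
  (2 * Om * k2 k * k3 k * knorm2 k - (be ^+ 2 / et) * k1 k * k2 k ^+ 2 * k3 k)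
    / Mden Om be et k.
Definition M2 (Om be et : R) (k : Z3) : R :=
  if k.2 == 0%R then 0 else
  (- (2 * Om * k1 k * k3 k * knorm2 k) - (be ^+ 2 / et) * k2 k ^+ 3 * k3 k)
    / Mden Om be et k.
Definition M3 (Om be et : R) (k : Z3) : R :=
  if k.2 == 0%R then 0 else
  ((be ^+ 2 / et) * k2 k ^+ 2 * (k1 k ^+ 2 + k2 k ^+ 2)) / Mden Om be et k.

Definition cnorm2 (z : R[i]) : R := complex.Re z ^+ 2 + complex.Im z ^+ 2.

Definition fcoef := Z3 -> R[i].

Definition wnorm2 (w : Z3 -> R) (th : fcoef) : \bar R :=
  \esum_(k in [set k : Z3 | k != (0, 0, 0)%R]) (w k * cnorm2 (th k))%:E.
Definition wnorm (w : Z3 -> R) (th : fcoef) : R := Num.sqrt (fine (wnorm2 w th)).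

Definition in_space (w : Z3 -> R) (th : fcoef) : Prop :=
  [/\ th (0, 0, 0)%R = 0,
      (forall k, th (zneg k) = conjc (th k)) &
      (wnorm2 w th < +oo)%E].

Definition Hweight (q : R) (k : Z3) : R := knorm k `^ (2 * q).
Definition Gweight (r s tau : R) (k : Z3) : R :=
  knorm k `^ (2 * r) * expR (2 * tau * knorm k `^ (1 / s)).

Definition zsummable (f : Z3 -> R[i]) : Prop :=
  (\esum_(k in [set: Z3]) (Num.sqrt (cnorm2 (f k)))%:E < +oo)%E.
Definition zsumR (g : Z3 -> R) : R :=
  fine (\esum_(k in [set: Z3]) (Num.max (g k) 0)%:E)
  - fine (\esum_(k in [set: Z3]) (Num.max (- g k) 0)%:E).
Definition zsum (f : Z3 -> R[i]) : R[i] :=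
  Complex (zsumR (fun k => complex.Re (f k))) (zsumR (fun k => complex.Im (f k))).

(* Fourier coefficient of u . grad theta at mode k, u = (-Delta)^{alpha/2} M theta:
   (u.grad theta)^(k) = sum_l  uhat(k-l) . (i l) thetahat(l),
   uhat(j) = |j|^alpha Mhat(j) thetahat(j). *)
Definition nl_term (al Om be et : R) (th : fcoef) (k l : Z3) : R[i] :=
  let j := zsub k l in
  Complex 0 1 *
  (Complex (knorm j `^ al *
     (M1 Om be et j * k1 l + M2 Om be et j * k2 l + M3 Om be et j * k3 l)) 0
   * th j * th l).
Definition nl (al Om be et : R) (th : fcoef) (k : Z3) : R[i] :=
  zsum (nl_term al Om be et th k).

(* theta : [0,T] -> X is a solution in L^oo(0,T;X) (X given by weight w)
   with initial datum th0: bounded in X on [0,T], and each Fourier mode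
   satisfies the time-integrated equation
      thetahat(t,k) = thetahat0(k) - int_0^t (u.grad theta)^(s,k) ds. *)
Definition is_sol (al Om be et : R) (w : Z3 -> R) (T : R) (th0 : fcoef)
    (th : R -> fcoef) : Prop :=
  [/\ (forall t, 0 <= t <= T -> in_space w (th t)),
      (exists M : R, forall t, 0 <= t <= T -> wnorm w (th t) <= M) &
      (forall t k, 0 <= t <= T ->
        [/\ (forall s, 0 <= s <= t -> zsummable (nl_term al Om be et (th s) k)),
            lebesgue_measure.-integrable `[0, t]
              (fun s => (complex.Re (nl al Om be et (th s) k))%:E),
            lebesgue_measure.-integrable `[0, t]
              (fun s => (complex.Im (nl al Om be et (th s) k))%:E) &
            th t k = th0 k -
              Complex (\int[lebesgue_measure]_(s in `[0, t])
                          complex.Re (nl al Om be et (th s) k))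
                      (\int[lebesgue_measure]_(s in `[0, t])
                          complex.Im (nl al Om be et (th s) k))])].

Definition loc_lip_wp (al Om be et : R) (wX wY : Z3 -> R) : Prop :=
  exists T K : R -> R -> R,
  [/\ {within [set p : R * R | 0 <= p.1 /\ 0 <= p.2],
        continuous (fun p : R * R => T p.1 p.2)},
      {within [set p : R * R | 0 <= p.1 /\ 0 <= p.2],
        continuous (fun p : R * R => K p.1 p.2)},
      (forall a b, 0 <= a -> 0 <= b -> 0 < T a b /\ 0 < K a b) &
      forall th01 th02 : fcoef, in_space wY th01 -> in_space wY th02 ->
        let T0 := T (wnorm wY th01) (wnorm wY th02) in
        let K0 := K (wnorm wY th01) (wnorm wY th02) in
        exists th1 th2 : R -> fcoef,
          [/\ is_sol al Om be et wX T0 th01 th1,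
              is_sol al Om be et wX T0 th02 th2,
              (forall phi, is_sol al Om be et wX T0 th01 phi ->
                 forall t, 0 <= t <= T0 -> phi t = th1 t),
              (forall phi, is_sol al Om be et wX T0 th02 phi ->
                 forall t, 0 <= t <= T0 -> phi t = th2 t) &
              (forall t, 0 <= t <= T0 ->
                 wnorm wX (fun k => th1 t k - th2 t k)
                   <= K0 * wnorm wY (fun k => th01 k - th02 k))]].

End Defs.

(* Main.v *)
(* The plane wave -sin x3 is a steady state, since M vanishes on vertical wave
   vectors.  Linearizing about it only couples the modes (a, b, n) with
   neighbouring n, with nonnegative coefficients w_n = |k|^al M3(k), and w_n is
   bounded in n.  On the parabola a = b^2 one has w_1, w_2 >= c b^(2 (al + 1)), so a
   perturbation of size e in the modes n = 1, 2 grows at least like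
   e exp(c b^(2 (al + 1)) t / 2), up to the quadratic remainder, which is O(e^2) by
   the assumed Lipschitz bound.  That bound also caps the growth by a multiple of
   the Gevrey norm of the perturbation, of order e exp(C b^(2/s)) up to powers of b.
   As 1/s < al + 1, taking b large and then e small gives a contradiction. *)
Require Import Defs.
From HB Require Import structures.
From mathcomp Require Import all_boot all_order all_algebra.
From mathcomp Require Import all_classical all_reals all_analysis.
From mathcomp Require Import complex.
From mathcomp Require Import ring lra.
Set Implicit Arguments. Unset Strict Implicit. Unset Printing Implicit Defensive.
Import Order.TTheory GRing.Theory Num.Theory.
Import numFieldNormedType.Exports.
Local Open Scope classical_set_scope.
Local Open Scope ring_scope.

(** * Integral comparison and growth in a chain of coupled modes *)

(** The time integrands of a solution are merely integrable, so the fundamental theorem of calculus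
    is applied to the continuous majorant [g]. It needs a nondegenerate interval, hence the separate
    case [t = 0]. *)
Lemma Rintegral_le_antiderivative (R : realType) (h G g : R -> R) (t : R) :
  0 <= t ->
  lebesgue_measure.-integrable `[0, t]%classic (EFin \o h) ->
  (forall x : R, is_derive x (1 : R) G (g x)) -> continuous g ->
  (forall x, 0 <= x <= t -> h x <= g x) ->
  \int[lebesgue_measure]_(x in `[0, t]%classic) h x <= G t - G 0.
Proof.
rewrite le_eqVlt => /predU1P[<- _ _ _ _|t0 ih dG cg hg].
  by rewrite set_itv1 Rintegral_set1 subrr.
have cG : continuous G by move=> x; apply/differentiable_continuous/derivable1_diffP/ex_derive.
have cgw : {within `[0, t]%classic, continuous g} by exact: continuous_subspaceT.
have ig : lebesgue_measure.-integrable `[0, t]%classic (EFin \o g).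
  by apply: continuous_compact_integrable => //; exact: segment_compact.
apply: (@le_trans _ _ (\int[lebesgue_measure]_(x in `[0, t]%classic) g x)).
  by apply: le_Rintegral => // x /=; rewrite in_itv/=; exact: hg.
rewrite /Rintegral (@continuous_FTC2 _ g G)//.
  split => [x _||]; first exact: ex_derive.
  - by apply: cvg_at_right_filter; exact: cG.
  - by apply: cvg_at_left_filter; exact: cG.
by move=> x _; rewrite derive1E; exact: derive_val.
Qed.

Section Growth.
Variable R : realType.

Let is_derive_expRZ (c a x : R) :
  is_derive x (1 : R) (fun y => c * expR (a * y)) (c * a * expR (a * x)).
Proof.
have d1 : is_derive x (1 : R) (fun y : R => a * y) a.
  have := @is_deriveZ _ _ _ (@id R) a x 1 1 (is_derive_id _ _).
  by rewrite /GRing.scale /= mulr1.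
have d2 := @is_derive1_comp R expR (fun y => a * y) x _ _ (is_derive_expR _) d1.
have := @is_deriveZ _ _ _ _ c x 1 _ d2.
by rewrite /GRing.scale /= [_ * a]mulrC mulrA.
Qed.

Let continuous_expRZ (c a : R) : continuous (fun y : R => c * expR (a * y)).
Proof.
move=> x; apply/differentiable_continuous/derivable1_diffP.
exact: (@ex_derive _ _ _ _ _ _ _ (is_derive_expRZ c a x)).
Qed.

(** An infinite system of inequalities [f n' >= (w (n - 1) * f (n - 1) + w (n + 1) * f (n + 1)) / 2
    - delta] in integrated form. The initial datum [c] is a sub-eigenvector of the coupling matrix,
    so [c n * expR (lam * t)] is a subsolution when [delta = 0]. *)
Variables (f h : int -> R -> R) (w c : int -> R) (T delta lam W : R).
Hypothesis (T0 : 0 <= T) (delta0 : 0 <= delta) (W0 : 0 < W).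
Hypothesis wW : forall n, 0 <= w n <= W.
Hypothesis c0 : forall n, 0 <= c n.
Hypothesis cw : forall n, 2 * lam * c n <= w (n - 1) * c (n - 1) + w (n + 1) * c (n + 1).
Hypothesis ih : forall n t, 0 <= t <= T ->
  lebesgue_measure.-integrable `[0, t]%classic (EFin \o h n).
Hypothesis fE : forall n t, 0 <= t <= T ->
  f n t = c n - \int[lebesgue_measure]_(s in `[0, t]%classic) h n s.
Hypothesis hle : forall n s, 0 <= s <= T ->
  h n s <= delta - (w (n - 1) * f (n - 1) s + w (n + 1) * f (n + 1) s) / 2.

(* The weight [expR (2 * W * t)] makes one Duhamel iteration halve the defect [S]. *)
Let growth_step (S : R) : 0 <= S ->
  (forall n t, 0 <= t <= T -> c n * expR (lam * t) - S * expR (2 * W * t) <= f n t) ->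
  forall n t, 0 <= t <= T ->
    c n * expR (lam * t) - (S / 2 + delta * T) * expR (2 * W * t) <= f n t.
Proof.
move=> S0 H n t /andP[t0 tT]; rewrite fE ?t0//.
(* Each of the two neighbours costs at most [W * S * expR (2 * W * s)], halved by the factor 1/2;
   integrating their sum divides by [2 * W] and leaves [S / 2]. *)
have key : \int[lebesgue_measure]_(s in `[0, t]%classic) h n s <=
  (delta * t + S / 2 * expR (2 * W * t) - c n * expR (lam * t)) -
  (delta * 0 + S / 2 * expR (2 * W * 0) - c n * expR (lam * 0)).
  apply: (@Rintegral_le_antiderivative _ _
    (fun s => delta * s + S / 2 * expR (2 * W * s) - c n * expR (lam * s))
    (fun s => delta + S * W * expR (2 * W * s) - c n * lam * expR (lam * s))) => //.
  - by apply: ih; rewrite t0.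
  - move=> x.
    have d1 : is_derive x (1 : R) (fun y : R => delta * y) delta.
      have := @is_deriveZ _ _ _ (@id R) delta x 1 1 (is_derive_id _ _).
      by rewrite /GRing.scale /= mulr1.
    have := is_deriveB (is_deriveD d1 (is_derive_expRZ (S / 2) (2 * W) x))
      (is_derive_expRZ (c n) lam x).
    by have -> : S / 2 * (2 * W) = S * W by field.
  - move=> x; apply: cvgB; last exact: continuous_expRZ.
    by apply: cvgD; [exact: cvg_cst|exact: continuous_expRZ].
  - move=> x /andP[x0 xt]; have xT : 0 <= x <= T by rewrite x0 (le_trans xt).
    apply: (le_trans (hle _ xT)).
    have step m : w m * (c m * expR (lam * x)) - W * (S * expR (2 * W * x)) <= w m * f m x.
      have /andP[wm0 wmW] := wW m.
      apply: (le_trans _ (ler_wpM2l wm0 (H m x xT))).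
      rewrite mulrBr lerD2l lerN2; apply: ler_wpM2r => //.
      by rewrite mulr_ge0 // expR_ge0.
    have := step (n - 1); have := step (n + 1).
    have := ler_wpM2r (expR_ge0 (lam * x)) (cw n).
    lra.
have dT : delta * t <= delta * T * expR (2 * W * t).
  rewrite -mulrA; apply: ler_wpM2l => //; apply: (le_trans tT).
  rewrite ler_peMr // -expR0 ler_expR !mulr_ge0 //; exact: ltW.
move: key; rewrite !mulr0 expR0 => key.
have : 0 <= S / 2 by rewrite divr_ge0.
move: key dT; set E := expR _; set E' := expR _; set J := Rintegral _ _ _.
rewrite mulrDl; lra.
Qed.

(** A crude bound uniform in [n] starts the iteration of [growth_step]. The map
    [S |-> S / 2 + delta * T] contracts to its fixed point [2 * delta * T], so [B] is absent from
    the conclusion. Nonnegativity of [w] lets lower bounds pass from neighbours. *)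
Lemma linear_growth (B : R) :
  (forall n t, 0 <= t <= T -> - B <= f n t) ->
  (forall n, c n * expR (`|lam| * T) <= B) ->
  forall n, c n * expR (lam * T) - 2 * delta * T * expR (2 * W * T) <= f n T.
Proof.
move=> fB cB n.
have B0 : 0 <= B by apply: (le_trans _ (cB 0)); rewrite mulr_ge0 ?expR_ge0.
have TT : 0 <= T <= T by rewrite T0 /=.
(* The initial defect is [2 * B]: one [B] for the lower bound on [f], one for the size of the
   subsolution. *)
have base m t : 0 <= t <= T -> c m * expR (lam * t) - (2 * B) * expR (2 * W * t) <= f m t.
  move=> tT; apply: (le_trans _ (fB m t tT)).
  have /andP[t0 tT'] := tT.
  have : 2 * B <= 2 * B * expR (2 * W * t).
    rewrite ler_peMr ?mulr_ge0// -expR0 ler_expR !mulr_ge0//; exact: ltW.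
  have : c m * expR (lam * t) <= B.
    apply: le_trans (cB m); apply: ler_wpM2l => //; rewrite ler_expR.
    apply: (le_trans (ler_wpM2r t0 (ler_norm lam))).
    exact: ler_wpM2l.
  lra.
have iter N m t : 0 <= t <= T -> c m * expR (lam * t)
    - (2 * B / 2 ^+ N + 2 * delta * T) * expR (2 * W * t) <= f m t.
  elim: N m t => [|N IH] m t tT.
    apply: (le_trans _ (base m t tT)); rewrite lerD2l lerN2 expr0 divr1.
    by apply: ler_wpM2r; [exact: expR_ge0|rewrite lerDl !mulr_ge0].
  have := growth_step _ IH m tT.
  have -> : (2 * B / 2 ^+ N + 2 * delta * T) / 2 + delta * T
     = 2 * B / 2 ^+ N.+1 + 2 * delta * T by rewrite exprS; field; rewrite expf_neq0.
  by apply; rewrite addr_ge0 ?divr_ge0 ?mulr_ge0 ?exprn_ge0.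
apply/ler_addgt0Pr => e e0.
set E := expR (2 * W * T).
have [N HN] : exists N : nat, 2 * B * E / 2 ^+ N <= e.
  have [N HN] : exists N : nat, 2 * B * E / e < N%:R.
    exists (Num.bound (2 * B * E / e)); apply: archi_boundP.
    by rewrite divr_ge0 ?(ltW e0)// !mulr_ge0// expR_ge0.
  exists N; rewrite ler_pdivrMr ?exprn_gt0// [e * _]mulrC -ler_pdivrMr//.
  apply: (le_trans (ltW HN)); rewrite -natrX ler_nat ltnW//; exact: ltn_expl.
have := iter N n T TT; rewrite -/E.
have -> : (2 * B / 2 ^+ N + 2 * delta * T) * E = 2 * B * E / 2 ^+ N + 2 * delta * T * E by ring.
lra.
Qed.

End Growth.

(** * Sums of nonnegative families and comparison of signed sums *)

Section NonnegativeSums.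
Variables (R : realType) (I : choiceType).
Implicit Types (f g : I -> R).

Lemma esum_finite_support (s : seq I) f : uniq s -> (forall k, 0 <= f k) ->
  (forall k, k \notin s -> f k = 0) ->
  (\esum_(k in [set: I]) (f k)%:E)%E = (\sum_(k <- s) f k)%:E.
Proof.
move=> us f0 fs.
have -> : (\esum_(k in [set: I]) (f k)%:E)%E = (\esum_(k in [set` s]) (f k)%:E)%E.
  rewrite [RHS]esum_mkcond; apply: eq_esum => k _; case: ifPn => // /negP ks.
  by rewrite fs//; apply/negP => sk; apply: ks; rewrite inE /=.
rewrite esum_fset//; last by move=> k _; rewrite lee_fin.
by rewrite -(fsbig_seq _ _ us) sumEFin.
Qed.

Lemma esumZ_le f (c M : R) : 0 <= c -> (forall k, 0 <= f k) ->
  (\esum_(k in [set: I]) (f k)%:E <= M%:E)%E ->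
  (\esum_(k in [set: I]) (c * f k)%:E <= (c * M)%:E)%E.
Proof.
move=> c0 f0 fM; apply: ge_ereal_sup => _ [X [finX _] <-].
have -> : (\sum_(k \in X) (c * f k)%:E = c%:E * \sum_(k \in X) (f k)%:E)%E.
  by rewrite ge0_mule_fsumr// => k; rewrite lee_fin.
rewrite EFinM; apply: lee_wpmul2l; first by rewrite lee_fin.
apply: le_trans fM; by apply: esum_ge; exists X.
Qed.

Lemma esum_fin_num f : (forall k, 0 <= f k) ->
  (\esum_(k in [set: I]) (f k)%:E < +oo)%E ->
  exists2 M : R, 0 <= M & (\esum_(k in [set: I]) (f k)%:E)%E = M%:E.
Proof.
move=> f0 foo.
have fge : (0 <= \esum_(k in [set: I]) (f k)%:E)%E.
  by apply: esum_ge0 => k _; rewrite lee_fin.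
exists (fine (\esum_(k in [set: I]) (f k)%:E)%E); first exact: fine_ge0.
by rewrite fineK// ge0_fin_numE.
Qed.

End NonnegativeSums.

(** Subtraction is avoided: with positive and negative parts moved to the proper sides, the claim
    compares sums of nonnegative families term by term. Absolute summability of [g] makes both of
    its parts finite, so that [fine] loses nothing. *)
Lemma zsumR_le (R : realType) (g A Q : Z3 -> R) (s : seq Z3) (M : R) :
  uniq s -> (forall l, l \notin s -> A l = 0) ->
  (forall l, 0 <= Q l) -> (\esum_(l in [set: Z3]) (Q l)%:E <= M%:E)%E ->
  (\esum_(l in [set: Z3]) `|g l|%:E < +oo)%E ->
  (forall l, g l <= A l + Q l) ->
  zsumR g <= \sum_(l <- s) A l + M.
Proof.
move=> us As Q0 QM gfin gAQ.
have max0 (x : R) : 0 <= Num.max x 0 by rewrite le_max lexx orbT.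
have part (h : Z3 -> R) : (forall l, h l <= `|g l|) ->
    (\esum_(l in [set: Z3]) (Num.max (h l) 0)%:E < +oo)%E.
  move=> hg; apply: le_lt_trans gfin; apply: le_esum => l _.
  by rewrite lee_fin ge_max hg normr_ge0.
have [P P0 PE] := esum_fin_num (fun l => max0 (g l)) (part _ (fun l => ler_norm _)).
have gN l : - g l <= `|g l| by rewrite -normrN ler_norm.
have [N N0 NE] := esum_fin_num (fun l => max0 (- g l))
  (part (fun l => - g l) gN).
rewrite /zsumR PE NE /=.
have ApE : (\esum_(l in [set: Z3]) (Num.max (A l) 0)%:E)%E = (\sum_(l <- s) Num.max (A l) 0)%:E.
  by apply: esum_finite_support => // l /As ->; rewrite maxxx.
have AnE : (\esum_(l in [set: Z3]) (Num.max (- A l) 0)%:E)%E = (\sum_(l <- s) Num.max (- A l) 0)%:E.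
  by apply: esum_finite_support => // l /As ->; rewrite oppr0 maxxx.
have : (P%:E + (\sum_(l <- s) Num.max (- A l) 0)%:E <=
   (\sum_(l <- s) Num.max (A l) 0)%:E + M%:E + N%:E)%E.
  rewrite -PE -NE -ApE -AnE.
  apply: (@le_trans _ _ (\esum_(l in [set: Z3]) (Num.max (A l) 0)%:E
    + \esum_(l in [set: Z3]) (Q l)%:E + \esum_(l in [set: Z3]) (Num.max (- g l) 0)%:E)%E); last first.
    by apply: leeD => //; apply: leeD.
  do 3!(rewrite -esumD; last 2 first;
    [by move=> l _; try apply: adde_ge0; rewrite lee_fin
    |by move=> l _; try apply: adde_ge0; rewrite lee_fin|]).
  apply: le_esum => l _.
  suff : Num.max (g l) 0 + Num.max (- A l) 0 <= Num.max (A l) 0 + Q l + Num.max (- g l) 0.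
    by rewrite -lee_fin !EFinD.
  have := gAQ l; case: (leP (g l) 0); case: (leP (- g l) 0); case: (leP (A l) 0);
    case: (leP (- A l) 0); lra.
rewrite -!EFinD lee_fin.
have -> : \sum_(l <- s) A l = \sum_(l <- s) Num.max (A l) 0 - \sum_(l <- s) Num.max (- A l) 0.
  rewrite -sumrB; apply: eq_bigr => l _.
  by case: (leP (A l) 0); case: (leP (- A l) 0); lra.
lra.
Qed.

(** * Weighted norms of Fourier coefficients *)

Section WeightedNorms.
Variable R : realType.
Implicit Types (w : Z3 -> R) (th ph : Z3 -> R[i]).

Lemma cnorm2_ge0 (z : R[i]) : 0 <= cnorm2 z.
Proof. by rewrite addr_ge0 ?sqr_ge0. Qed.

Lemma cnorm2B (x y : R[i]) : cnorm2 (x - y) <= 2 * cnorm2 x + 2 * cnorm2 y.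
Proof.
case: x y => [a b] [c d]; rewrite /cnorm2 /=.
have := sqr_ge0 (a + c); have := sqr_ge0 (b + d); rewrite !expr2; lra.
Qed.

Lemma wnorm2E w th : th (0, 0, 0)%R = 0 ->
  wnorm2 w th = (\esum_(k in [set: Z3]) (w k * cnorm2 (th k))%:E)%E.
Proof.
move=> th0; rewrite /wnorm2 esum_mkcond; apply: eq_esum => k _.
case: ifPn => //; rewrite notin_setE /= => /negP; rewrite negbK => /eqP ->.
by rewrite th0 /cnorm2 /= expr0n addr0 mulr0.
Qed.

(** [fine] sends [+oo] to 0, so [wnorm] carries information only once finiteness is known. *)
Lemma wnorm2_fine w th : (forall k, 0 <= w k) -> (wnorm2 w th < +oo)%E ->
  wnorm2 w th = (wnorm w th ^+ 2)%:E.
Proof.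
move=> w0 foo.
have ge : (0 <= wnorm2 w th)%E.
  by apply: esum_ge0 => k _; rewrite lee_fin mulr_ge0 // cnorm2_ge0.
rewrite /wnorm sqr_sqrtr; last exact: fine_ge0.
by rewrite fineK// ge0_fin_numE.
Qed.

Lemma wnorm2_mode w th (k : Z3) : (forall k, 0 <= w k) -> (wnorm2 w th < +oo)%E ->
  k != (0, 0, 0)%R -> w k * cnorm2 (th k) <= wnorm w th ^+ 2.
Proof.
move=> w0 foo k0; rewrite -lee_fin -(wnorm2_fine w0 foo).
apply: esum_ge; exists [set k]; last by rewrite fsbig_set1.
by split => // _ ->.
Qed.

Lemma wnorm2B_fin w th ph : (forall k, 0 <= w k) ->
  th (0, 0, 0)%R = 0 -> ph (0, 0, 0)%R = 0 ->
  (wnorm2 w th < +oo)%E -> (wnorm2 w ph < +oo)%E ->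
  (wnorm2 w (fun k => th k - ph k)%R < +oo)%E.
Proof.
move=> w0 th0 ph0 thoo phoo.
have thE := wnorm2_fine w0 thoo; have phE := wnorm2_fine w0 phoo.
rewrite !wnorm2E ?th0 ?ph0 ?subrr// in thE phE *.
have bnd x y : 0 <= w x * cnorm2 (y x) by rewrite mulr_ge0 ?cnorm2_ge0.
apply: (@le_lt_trans _ _ (\esum_(k in [set: Z3]) (2 * (w k * cnorm2 (th k)))%:E
   + \esum_(k in [set: Z3]) (2 * (w k * cnorm2 (ph k)))%:E)%E).
  rewrite -esumD; try by move=> k _; rewrite lee_fin mulr_ge0.
  apply: le_esum => k _; rewrite -EFinD lee_fin.
  have := ler_wpM2l (w0 k) (cnorm2B (th k) (ph k)).
  lra.
apply: (@le_lt_trans _ _ ((2 * wnorm w th ^+ 2)%:E + (2 * wnorm w ph ^+ 2)%:E)%E).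
  by apply: leeD; apply: esumZ_le => //; rewrite ?thE ?phE.
by rewrite -EFinD ltry.
Qed.

Lemma wnorm2_finite_support w th (s : seq Z3) : uniq s -> (forall k, 0 <= w k) ->
  th (0, 0, 0)%R = 0 -> (forall k, k \notin s -> th k = 0) ->
  wnorm2 w th = (\sum_(k <- s) w k * cnorm2 (th k))%:E.
Proof.
move=> us w0 th0 ths; rewrite wnorm2E//; apply: esum_finite_support => //.
  by move=> k; rewrite mulr_ge0 ?cnorm2_ge0.
by move=> k /ths ->; rewrite /cnorm2 /= expr0n addr0 mulr0.
Qed.

(** Pythagoras, meant for a purely imaginary [th] and a real [ph], whose cross terms vanish mode by
    mode. *)
Lemma wnorm2_orthogonal w th ph ps : (forall k, 0 <= w k) ->
  th (0, 0, 0)%R = 0 -> ph (0, 0, 0)%R = 0 -> ps (0, 0, 0)%R = 0 ->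
  (forall k, cnorm2 (ps k) = cnorm2 (th k) + cnorm2 (ph k)) ->
  (wnorm2 w ps = wnorm2 w th + wnorm2 w ph)%E.
Proof.
move=> w0 th0 ph0 ps0 psE; rewrite !wnorm2E// -esumD.
- by apply: eq_esum => k _; rewrite psE mulrDr EFinD.
- by move=> k _; rewrite lee_fin mulr_ge0 ?cnorm2_ge0.
- by move=> k _; rewrite lee_fin mulr_ge0 ?cnorm2_ge0.
Qed.

End WeightedNorms.

(** * Wavenumbers and bounds on the multiplier *)

Section Wavenumbers.
Variable R : realType.
Implicit Types (k j l : Z3).

Lemma knorm2_ge0 k : 0 <= knorm2 R k.
Proof. by rewrite !addr_ge0 ?sqr_ge0. Qed.

Lemma sqr_knorm k : knorm R k ^+ 2 = knorm2 R k.
Proof. exact/sqr_sqrtr/knorm2_ge0. Qed.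

Lemma knorm_ge0 k : 0 <= knorm R k.
Proof. exact: sqrtr_ge0. Qed.

Let ge1_sqr_int (x : int) : x != 0 -> 1 <= (x%:~R : R) ^+ 2.
Proof.
move=> x0; rewrite -real_normK ?num_real// -intr_norm exprn_ege1//.
by rewrite ler1z -gtz0_ge1 normr_gt0.
Qed.

Lemma knorm_ge1 k : k != (0, 0, 0)%R -> 1 <= knorm R k.
Proof.
case: k => [[a b] c] k0; rewrite -(ler_pXn2r (n := 2)) ?nnegrE ?knorm_ge0// expr1n sqr_knorm.
rewrite /knorm2 /k1 /k2 /k3 /=.
have := sqr_ge0 (a%:~R : R); have := sqr_ge0 (b%:~R : R); have := sqr_ge0 (c%:~R : R).
case: (eqVneq a 0) => [a0|/ge1_sqr_int]; last lra.
case: (eqVneq b 0) => [b0|/ge1_sqr_int]; last lra.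
case: (eqVneq c 0) => [c0|/ge1_sqr_int]; last lra.
by move: k0; rewrite a0 b0 c0 eqxx.
Qed.

Let le_knorm (x : R) k : x ^+ 2 <= knorm2 R k -> `|x| <= knorm R k.
Proof. by move=> xk; rewrite -sqrtr_sqr ler_wsqrtr. Qed.

Lemma norm_k1_le k : `|k1 R k| <= knorm R k.
Proof. by apply: le_knorm; rewrite /knorm2 -addrA lerDl addr_ge0 ?sqr_ge0. Qed.

Lemma norm_k2_le k : `|k2 R k| <= knorm R k.
Proof. by apply: le_knorm; rewrite /knorm2 addrAC lerDr addr_ge0 ?sqr_ge0. Qed.

Lemma norm_k3_le k : `|k3 R k| <= knorm R k.
Proof. by apply: le_knorm; rewrite /knorm2 lerDr addr_ge0 ?sqr_ge0. Qed.

Lemma norm_k3_ge1 k : k.2 != 0%R -> 1 <= `|k3 R k|.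
Proof. by move=> k0; rewrite /k3 -intr_norm ler1z -gtz0_ge1 normr_gt0. Qed.

Variables (Om be et : R).
Hypotheses (Om0 : 0 < Om) (be0 : 0 < be) (et0 : 0 < et).
Let c := be ^+ 2 / et.
Let c0 : 0 < c. Proof. by rewrite divr_gt0 ?exprn_gt0. Qed.

Lemma Mden_gt0 k : k.2 != 0%R -> 0 < Mden Om be et k.
Proof.
move=> k0; rewrite /Mden ltr_pwDl//; last by rewrite mulr_ge0 ?sqr_ge0// exprn_even_ge0.
have z1 := norm_k3_ge1 k0.
have N0 : 0 < knorm R k by apply: lt_le_trans ltr01 (le_trans z1 (norm_k3_le k)).
have z0 : 0 < `|k3 R k| by apply: lt_le_trans z1.
by rewrite -sqr_knorm -[k3 R k ^+ 2]real_normK ?num_real// !mulr_gt0// exprn_gt0.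
Qed.

(* With [X = 2 Om |k3| |k|] and [Y = c k2^2] the denominator is [X^2 + Y^2], which
   dominates both [X^2] and [2 X Y]. *)
Let num_bound1 k (x : R) : k.2 != 0%R -> `|x| <= knorm R k ->
  2 * Om * `|x| * `|k3 R k| * knorm2 R k <= (2 * Om)^-1 * knorm R k * Mden Om be et k.
Proof.
move=> k0; have z1 := norm_k3_ge1 k0; have N0 := knorm_ge0 k.
move=> b1.
apply: (@le_trans _ _ ((2 * Om)^-1 * knorm R k * (4 * Om ^+ 2 * k3 R k ^+ 2 * knorm2 R k))).
  rewrite -sqr_knorm -[k3 R k ^+ 2]real_normK ?num_real//.
  move: z1 b1 N0; set z := `|k3 R k|; set b := `|x|; set N := knorm R k => z1 b1 N0.
  have -> : (2 * Om)^-1 * N * (4 * Om ^+ 2 * z ^+ 2 * N ^+ 2) = 2 * Om * N ^+ 2 * z * (N * z).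
    by field; rewrite gt_eqF.
  have -> : 2 * Om * b * z * N ^+ 2 = 2 * Om * N ^+ 2 * z * (b * 1) by ring.
  apply: ler_wpM2l; first by rewrite !mulr_ge0 ?sqr_ge0 ?(ltW Om0)// (le_trans _ z1).
  by apply: ler_pM; rewrite ?normr_ge0.
apply: ler_wpM2l; first by rewrite mulr_ge0// invr_ge0 mulr_ge0// ltW.
by rewrite /Mden lerDl mulr_ge0 ?sqr_ge0// exprn_even_ge0.
Qed.

Let num_bound2 k : k.2 != 0%R ->
  c * k2 R k ^+ 2 * `|k3 R k| * knorm2 R k <= (4 * Om)^-1 * knorm R k * Mden Om be et k.
Proof.
move=> k0; have z1 := norm_k3_ge1 k0; have N0 := knorm_ge0 k.
have -> : c * k2 R k ^+ 2 * `|k3 R k| * knorm2 R k =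
   (4 * Om)^-1 * knorm R k * (2 * (2 * Om * `|k3 R k| * knorm R k) * (c * k2 R k ^+ 2)).
  by rewrite -sqr_knorm; field; rewrite gt_eqF.
apply: ler_wpM2l; first by rewrite mulr_ge0// invr_ge0 mulr_ge0// ltW.
rewrite /Mden -/c -sqr_knorm -[k3 R k ^+ 2]real_normK ?num_real//.
rewrite -subr_ge0.
have -> : 4 * Om ^+ 2 * `|k3 R k| ^+ 2 * knorm R k ^+ 2 + c ^+ 2 * k2 R k ^+ 4 -
    2 * (2 * Om * `|k3 R k| * knorm R k) * (c * k2 R k ^+ 2) =
  (2 * Om * `|k3 R k| * knorm R k - c * k2 R k ^+ 2) ^+ 2 by rewrite /Mden; ring.
exact: sqr_ge0.
Qed.

Let knorm_sq_ge k : k.2 != 0%R -> knorm R k <= knorm2 R k.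
Proof.
move=> k0; rewrite -sqr_knorm expr2 ler_peMr ?knorm_ge0//.
exact: le_trans (norm_k3_ge1 k0) (norm_k3_le k).
Qed.

Let num_bound2' k (x : R) : k.2 != 0%R -> `|x| <= knorm R k ->
  c * `|x| * k2 R k ^+ 2 * `|k3 R k| <= (4 * Om)^-1 * knorm R k * Mden Om be et k.
Proof.
move=> k0 xN; apply: le_trans (num_bound2 k0).
have -> : c * `|x| * k2 R k ^+ 2 * `|k3 R k| = c * k2 R k ^+ 2 * `|k3 R k| * `|x| by ring.
apply: ler_wpM2l; last by apply: (le_trans xN); exact: knorm_sq_ge.
have Y0 : 0 <= c * k2 R k ^+ 2 by apply: mulr_ge0; [exact: ltW c0|exact: sqr_ge0].
by rewrite mulr_ge0.
Qed.

Let Mbound k (x C : R) : k.2 != 0%R -> `|x| <= C * knorm R k * Mden Om be et k ->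
  `|x / Mden Om be et k| <= C * knorm R k.
Proof.
move=> k0 xC; have D0 := Mden_gt0 k0.
by rewrite normrM normfV (gtr0_norm D0) ler_pdivrMr.
Qed.

(** The multiplier has order one: the two terms of the numerator contribute 1/(2 Om) and 1/(4 Om),
    together below 1/Om. *)
Lemma norm_M1_le k : `|M1 Om be et k| <= Om^-1 * knorm R k.
Proof.
rewrite /M1; case: ifPn => [_|k0]; first by rewrite normr0 mulr_ge0 ?knorm_ge0// invr_ge0 ltW.
apply: Mbound => //; apply: (le_trans (ler_normB _ _)).
have b1 := num_bound1 k0 (norm_k2_le k); have b2 := num_bound2' k0 (norm_k1_le k).
rewrite -/c 4!normrM (ger0_norm (knorm2_ge0 _)) (gtr0_norm Om0) normr_nat.
rewrite 3!normrM (gtr0_norm c0) (ger0_norm (sqr_ge0 (k2 R k))).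
apply: (le_trans (lerD b1 b2)); rewrite -mulrDl -mulrDl -!mulrA.
apply: ler_wpM2r; first by rewrite mulr_ge0 ?knorm_ge0// ltW ?Mden_gt0.
by rewrite !invfM -mulrDl ler_piMl ?invr_ge0 ?(ltW Om0)//; lra.
Qed.

Lemma norm_M2_le k : `|M2 Om be et k| <= Om^-1 * knorm R k.
Proof.
rewrite /M2; case: ifPn => [_|k0]; first by rewrite normr0 mulr_ge0 ?knorm_ge0// invr_ge0 ltW.
apply: Mbound => //; apply: (le_trans (ler_normB _ _)); rewrite normrN.
have b2 := num_bound2' k0 (norm_k2_le k).
have b1 := num_bound1 k0 (norm_k1_le k).
rewrite -/c 4!normrM (ger0_norm (knorm2_ge0 _)) (gtr0_norm Om0) normr_nat.
rewrite 2!normrM (gtr0_norm c0) normrX.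
have -> : `|k2 R k| ^+ 3 = `|k2 R k| * k2 R k ^+ 2.
  by rewrite -[k2 R k ^+ 2]real_normK ?num_real// -exprS.
rewrite [c * _]mulrA.
apply: (le_trans (lerD b1 b2)); rewrite -mulrDl -mulrDl -!mulrA.
apply: ler_wpM2r; first by rewrite mulr_ge0 ?knorm_ge0// ltW ?Mden_gt0.
by rewrite !invfM -mulrDl ler_piMl ?invr_ge0 ?(ltW Om0)//; lra.
Qed.

Lemma M3_ge0 k : 0 <= M3 Om be et k.
Proof.
rewrite /M3; case: ifPn => // k0.
have Y0 : 0 <= c * k2 R k ^+ 2 by apply: mulr_ge0; [exact: ltW c0|exact: sqr_ge0].
by rewrite divr_ge0 ?(ltW (Mden_gt0 k0))// mulr_ge0// addr_ge0 ?sqr_ge0.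
Qed.

Lemma norm_M3_le k : `|M3 Om be et k| <= Om^-1 * knorm R k.
Proof.
rewrite /M3; case: ifPn => [_|k0]; first by rewrite normr0 mulr_ge0 ?knorm_ge0// invr_ge0 ltW.
apply: Mbound => //; rewrite -/c.
have Y0 : 0 <= c * k2 R k ^+ 2 by apply: mulr_ge0; [exact: ltW c0|exact: sqr_ge0].
rewrite ger0_norm; last by apply: mulr_ge0 => //; apply: addr_ge0; exact: sqr_ge0.
(* A factor [|k3| >= 1] is inserted to reach the form handled by [num_bound2]. *)
apply: (@le_trans _ _ (c * k2 R k ^+ 2 * `|k3 R k| * knorm2 R k)).
  rewrite -[leRHS]mulrA; apply: ler_wpM2l => //.
  apply: (@le_trans _ _ (1 * knorm2 R k)).
    by rewrite mul1r /knorm2 lerDl sqr_ge0.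
  by apply: ler_wpM2r; [exact: knorm2_ge0|exact: norm_k3_ge1].
apply: (le_trans (num_bound2 k0)); rewrite -!mulrA.
apply: ler_wpM2r; first by rewrite mulr_ge0 ?knorm_ge0// ltW ?Mden_gt0.
by rewrite invfM ler_piMl ?invr_ge0 ?(ltW Om0)//; lra.
Qed.

(** The real symbol of [u . grad] for a velocity mode [j] and a gradient mode [l]; [nl_term]
    supplies the factor i and the two coefficients. *)
Definition velocity_symbol (al : R) j l : R :=
  knorm R j `^ al * (M1 Om be et j * k1 R l + M2 Om be et j * k2 R l + M3 Om be et j * k3 R l).

Lemma norm_velocity_symbol_le al j l : 0 <= al ->
  `|velocity_symbol al j l| <= 3 / Om * (knorm R j `^ (al + 1) * knorm R l).
Proof.
move=> al0; rewrite normrM ger0_norm ?powR_ge0//.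
have -> : 3 / Om * (knorm R j `^ (al + 1) * knorm R l) =
    knorm R j `^ al * (3 / Om * knorm R j * knorm R l).
  have [->|j0] := eqVneq (knorm R j) 0.
    by rewrite (powR0 (lt0r_neq0 (ltr_pwDr ltr01 al0))) !mul0r mulr0 mul0r mulr0.
  by rewrite powRD ?j0 ?implybT// powRr1 ?knorm_ge0//; ring.
apply: ler_wpM2l; first exact: powR_ge0.
have st (x y : R) : `|x| <= Om^-1 * knorm R j -> `|y| <= knorm R l ->
    `|x * y| <= Om^-1 * knorm R j * knorm R l.
  by move=> *; rewrite normrM; apply: ler_pM.
have h1 := st _ _ (norm_M1_le j) (norm_k1_le l).
have h2 := st _ _ (norm_M2_le j) (norm_k2_le l).
have h3 := st _ _ (norm_M3_le j) (norm_k3_le l).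
apply: (le_trans (ler_normD _ _)); apply: (le_trans (lerD (ler_normD _ _) (lexx _))).
by rewrite -!mulrA; rewrite -!mulrA in h1 h2 h3; lra.
Qed.

End Wavenumbers.

(** * Bounds on the quadratic nonlinearity *)

Section Bilinear.
Variables (R : realType) (Om be et al q : R).
Hypotheses (Om0 : 0 < Om) (be0 : 0 < be) (et0 : 0 < et) (al0 : 0 <= al) (alq : al + 1 <= q).

Lemma Hweight_ge0 (k : Z3) : 0 <= Hweight q k.
Proof. exact: powR_ge0. Qed.

Lemma powR_knorm_le_Hweight (p : R) (k : Z3) : k != (0, 0, 0)%R -> p <= q ->
  (knorm R k `^ p) ^+ 2 <= Hweight q k.
Proof.
move=> k0 pq; rewrite /Hweight -powR_mulrn ?powR_ge0// -powRrM.
by apply: ler_powR; [exact: knorm_ge1|rewrite mulrC ler_wpM2l].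
Qed.

Lemma zsubK (k : Z3) : involutive (zsub k).
Proof. by case: k => [[x y] z] [[a b] c]; rewrite /zsub /= !subKr. Qed.

Lemma zsub_bij (k : Z3) : set_bij [set: Z3] [set: Z3] (zsub k).
Proof.
split => //; first by move=> x y _ _ /(congr1 (zsub k)); rewrite !zsubK.
by move=> x _; exists (zsub k x) => //; rewrite zsubK.
Qed.

Lemma Re_nl_term (th : Z3 -> R[i]) (k l : Z3) :
  complex.Re (nl_term al Om be et th k l) =
  - (velocity_symbol Om be et al (zsub k l) l * complex.Im (th (zsub k l) * th l)).
Proof.
rewrite /nl_term -/(velocity_symbol Om be et al (zsub k l) l).
move: (velocity_symbol _ _ _ _ _ _) => m.
case: (th (zsub k l)) => a b; case: (th l) => c d /=.
by ring.
Qed.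

(* AM-GM: [2 |Im (x y)| P Q <= P^2 |x|^2 + Q^2 |y|^2] *)
Lemma norm_Im_mul_le (x y : R[i]) (P Q : R) : 0 <= P -> 0 <= Q ->
  2 * (P * Q * `|complex.Im (x * y)|) <= P ^+ 2 * cnorm2 x + Q ^+ 2 * cnorm2 y.
Proof.
move=> P0 Q0; rewrite -[P * Q]ger0_norm ?mulr_ge0// -normrM /cnorm2.
case: x y => [a b] [c d] /=.
have h1 := sqr_ge0 (P * a - Q * d); have h2 := sqr_ge0 (P * b - Q * c).
have h3 := sqr_ge0 (P * a + Q * d); have h4 := sqr_ge0 (P * b + Q * c).
rewrite !expr2 in h1 h2 h3 h4 *.
case: ger0P => _; lra.
Qed.

(** The symbol costs [al + 1] derivatives on one factor and one on the other, both at most [q].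
    AM-GM then splits the product into two [H^q] densities, each summable in [l]. *)
Lemma bilinear_term_le (ps : Z3 -> R[i]) (j l : Z3) : ps (0, 0, 0)%R = 0 ->
  `|velocity_symbol Om be et al j l * complex.Im (ps j * ps l)| <=
  3 / (2 * Om) * (Hweight q j * cnorm2 (ps j) + Hweight q l * cnorm2 (ps l)).
Proof.
move=> ps0; have O0 : 0 <= 3 / (2 * Om) by rewrite divr_ge0// mulr_ge0// ltW.
have c0 z : 0 <= Hweight q z * cnorm2 (ps z) by rewrite mulr_ge0 ?cnorm2_ge0 ?Hweight_ge0.
have [->|j0] := eqVneq j (0, 0, 0)%R.
  by rewrite ps0 mul0r mulr0 normr0 mulr_ge0// addr_ge0// -?ps0.
have [->|l0] := eqVneq l (0, 0, 0)%R.
  by rewrite ps0 mulr0 mulr0 normr0 mulr_ge0// addr_ge0// -?ps0.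
rewrite normrM.
have h := norm_velocity_symbol_le Om0 be0 et0 j l al0.
apply: (le_trans (ler_wpM2r (normr_ge0 _) h)).
have := norm_Im_mul_le (ps j) (ps l) (powR_ge0 (knorm R j) (al + 1)) (knorm_ge0 R l).
have hj := ler_wpM2r (cnorm2_ge0 (ps j)) (powR_knorm_le_Hweight j0 alq).
have q1 : 1 <= q by apply: le_trans alq; rewrite lerDr.
have hl := ler_wpM2r (cnorm2_ge0 (ps l)) (powR_knorm_le_Hweight l0 q1).
rewrite powRr1 ?knorm_ge0// in hl.
move=> key; have := le_trans key (lerD hj hl) => {}key.
have E (x y : R) : 3 / Om * x * y = 3 / (2 * Om) * (2 * (x * y)) by field; rewrite gt_eqF.
by rewrite E; apply: ler_wpM2l.
Qed.

(** The reflection [l |-> k - l] is a bijection of the lattice, so both halves sum to at most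
    [B]. *)
Lemma bilinear_sum_le (ps : Z3 -> R[i]) (k : Z3) (B : R) : ps (0, 0, 0)%R = 0 ->
  (wnorm2 (Hweight q) ps <= B%:E)%E ->
  (\esum_(l in [set: Z3])
     (3 / (2 * Om) * (Hweight q (zsub k l) * cnorm2 (ps (zsub k l)) + Hweight q l * cnorm2 (ps l)))%:E
   <= (3 / Om * B)%:E)%E.
Proof.
move=> ps0; rewrite wnorm2E// => hB.
have c0 z : 0 <= Hweight q z * cnorm2 (ps z) by rewrite mulr_ge0 ?cnorm2_ge0 ?Hweight_ge0.
have -> : 3 / Om * B = 3 / (2 * Om) * (B + B) by field; rewrite gt_eqF.
apply: esumZ_le => [|l|]; [by rewrite divr_ge0// mulr_ge0// ltW|by rewrite addr_ge0|].
under eq_esum do rewrite EFinD.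
rewrite esumD; try by move=> l _; rewrite lee_fin.
rewrite EFinD; apply: leeD => //.
by rewrite -(reindex_esum _ _ _ (fun l => (Hweight q l * cnorm2 (ps l))%:E) (zsub_bij k)).
Qed.

End Bilinear.

(** * The steady state and the linearization about it *)

Section SteadyState.
Variables (R : realType) (Om be et al : R).
Hypotheses (Om0 : 0 < Om) (be0 : 0 < be) (et0 : 0 < et) (al0 : 0 <= al).

(* The Fourier coefficients of [- sin x3]; this sign makes all couplings in the
   linearization nonnegative. *)
Definition steady (k : Z3) : R[i] :=
  if k == (0, 0, 1)%R then Complex 0 (1 / 2)
  else if k == (0, 0, - 1)%R then Complex 0 (- (1 / 2)) else 0.

Lemma steady_support k : k \notin [:: (0, 0, 1); (0, 0, - 1)]%R -> steady k = 0.
Proof. by rewrite /steady !inE negb_or => /andP[/negPf -> /negPf ->]. Qed.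

Lemma velocity_symbol_vertical (n : int) (l : Z3) :
  velocity_symbol Om be et al (0, 0, n)%R l = 0.
Proof.
rewrite /velocity_symbol /M1 /M2 /M3 /k1 /k2 /=; case: ifP => _.
  by rewrite !mul0r !addr0 mulr0.
by rewrite !(mulr0, mul0r, expr0n, oppr0, addr0, subr0) /= ?(mulr0, mul0r, addr0, subr0).
Qed.

(** The steady state generates no velocity. In the expansion of the nonlinearity only terms with the
    perturbation in the velocity slot survive. *)
Lemma steady_or_symbol0 (j l : Z3) : steady j = 0 \/ velocity_symbol Om be et al j l = 0.
Proof.
rewrite /steady; case: eqP => [->|_]; first by right; exact: velocity_symbol_vertical.
by case: eqP => [->|_]; [right; exact: velocity_symbol_vertical|left].
Qed.

Lemma nl_term_steady (k l : Z3) : nl_term al Om be et steady k l = 0.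
Proof.
rewrite /nl_term -/(velocity_symbol Om be et al (zsub k l) l).
have [->|->] := steady_or_symbol0 (zsub k l) l; first by rewrite mulr0 mul0r mulr0.
by rewrite (_ : Complex (0 : R) 0 = 0)// !mul0r mulr0.
Qed.

Lemma nl_steady (k : Z3) : nl al Om be et steady k = 0.
Proof.
rewrite /nl /zsum; have z (g : Z3 -> R) : (forall l, g l = 0) -> zsumR g = 0.
  move=> g0; rewrite /zsumR !esum1 ?subrr// => l _; rewrite g0 ?oppr0 maxxx//.
by rewrite !z// => l; rewrite nl_term_steady.
Qed.

Lemma steady_in_space (w : Z3 -> R) : (forall k, 0 <= w k) -> in_space w steady.
Proof.
move=> w0; split => //; last first.
  rewrite (@wnorm2_finite_support _ _ _ [:: (0, 0, 1); (0, 0, - 1)]%R) ?ltry//.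
  exact: steady_support.
case=> [[x y] z]; rewrite /steady /zneg /= !xpair_eqE !oppr_eq0.
case: (x == 0); case: (y == 0) => /=; rewrite ?oppr0 //.
by case: z => [[|[|z]]|[|z]] //=; rewrite ?oppr0 ?opprK.
Qed.

Lemma steady_is_sol (w : Z3 -> R) (T : R) : (forall k, 0 <= w k) ->
  is_sol al Om be et w T steady (fun=> steady).
Proof.
move=> w0; split.
- by move=> t _; exact: steady_in_space.
- by exists (wnorm w steady).
- move=> t k _.
  pose th := (fun=> steady) : R -> Z3 -> R[i].
  have nl0 u : nl al Om be et (th u) k = 0 by exact: nl_steady.
  split.
  + move=> u _; rewrite /zsummable esum1 ?ltry// => l _.
    by rewrite nl_term_steady /cnorm2 /= expr0n addr0 sqrtr0.
  + rewrite (_ : (fun _ => _) = cst 0%E); first exact: integrable0.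
    by apply: funext => u; rewrite (nl0 u).
  + rewrite (_ : (fun _ => _) = cst 0%E); first exact: integrable0.
    by apply: funext => u; rewrite (nl0 u).
  + rewrite (_ : Complex _ _ = 0) ?subr0//.
    by congr Complex; rewrite /Rintegral integral0_eq// => u _; rewrite (nl0 u).
Qed.

(** The symbol of the vertical velocity of mode [(a, b, n)]; it is the only component that meets the
    gradient of a function of x3. *)
Definition coupling (a b n : int) : R :=
  knorm R (a, b, n) `^ al * M3 Om be et (a, b, n).

(** The linear part lives at [l = (0, 0, 1)] and [l = (0, 0, -1)], thus at velocity modes [n - 1]
    and [n + 1]. The sign of [k3 l] cancels that of the coefficient i/2 or -i/2 of [steady], so both
    contributions have the same sign. The part quadratic in [ps] is bounded by [bilinear_sum_le]. *)
Lemma Re_nl_le (q B : R) (th ps : Z3 -> R[i]) (a b n : int) : al + 1 <= q ->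
  ps (0, 0, 0)%R = 0 -> (forall k, th k = steady k + ps k) ->
  (wnorm2 (Hweight q) ps <= B%:E)%E ->
  zsummable (nl_term al Om be et th (a, b, n)) ->
  complex.Re (nl al Om be et th (a, b, n)) <= 3 / Om * B -
    (coupling a b (n - 1) * complex.Re (ps (a, b, n - 1)) +
     coupling a b (n + 1) * complex.Re (ps (a, b, n + 1))) / 2.
Proof.
move=> alq ps0 thE hB sumth; rewrite /nl /zsum /=.
pose k : Z3 := (a, b, n).
pose A l := - (velocity_symbol Om be et al (zsub k l) l * complex.Im (ps (zsub k l) * steady l)).
have -> : 3 / Om * B - (coupling a b (n - 1) * complex.Re (ps (a, b, n - 1)) +
     coupling a b (n + 1) * complex.Re (ps (a, b, n + 1))) / 2 =
   \sum_(l <- [:: (0, 0, 1); (0, 0, - 1)]%R) A l + 3 / Om * B.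
  rewrite big_cons big_seq1 /A /velocity_symbol /k /zsub /= !subr0 opprK.
  rewrite /coupling /k1 /k2 /k3 /steady /=.
  case: (ps (a, b, n - 1)) => x1 y1; case: (ps (a, b, n + 1)) => x2 y2 /=.
  rewrite mulrN1z; lra.
apply: (@zsumR_le _ _ _ (fun l => 3 / (2 * Om) * (Hweight q (zsub k l) * cnorm2 (ps (zsub k l))
   + Hweight q l * cnorm2 (ps l)))) => //.
- by move=> l ls; rewrite /A steady_support// mulr0 mulr0 oppr0.
- move=> l; rewrite mulr_ge0 ?addr_ge0 ?mulr_ge0 ?cnorm2_ge0 ?Hweight_ge0//.
  by rewrite invr_ge0 mulr_ge0// ltW.
- exact: bilinear_sum_le.
- apply: le_lt_trans sumth; apply: le_esum => l _; rewrite lee_fin -sqrtr_sqr.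
  by apply: ler_wsqrtr; rewrite /cnorm2 lerDl sqr_ge0.
- move=> l; rewrite Re_nl_term /A.
  have -> : velocity_symbol Om be et al (zsub k l) l * complex.Im (th (zsub k l) * th l) =
    velocity_symbol Om be et al (zsub k l) l * complex.Im (ps (zsub k l) * steady l) +
    velocity_symbol Om be et al (zsub k l) l * complex.Im (ps (zsub k l) * ps l).
    (* Either the velocity coefficient is that of [ps] alone, or the whole term vanishes. *)
    have [s0|->] := steady_or_symbol0 (zsub k l) l; last by rewrite !mul0r addr0.
    rewrite !thE s0 add0r -mulrDr; congr (_ * _).
    by case: (ps (zsub k l)) (steady l) (ps l) => [? ?] [? ?] [? ?] /=; ring.
  rewrite opprD lerD2l; apply: le_trans (ler_norm _) _; rewrite normrN.
  exact: bilinear_term_le.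
Qed.

End SteadyState.

(** * Gevrey weights against coupling strength at high frequency *)

(** With [y = (3 * x) ^ p >= 1], the factors [L], [(3 * x) ^ r = y ^ (r / p)] and the exponential
    are absorbed into [expR (C * y)], since [y] and [expR (ln y)] lie below [expR y]. The higher
    power [p'] then wins. Only squares [x] occur, as required on the parabola. *)
Lemma polynomial_exp_lt_exp (R : realType) (L c r t p p' : R) :
  0 <= L -> 0 < c -> 0 <= r -> 0 <= t -> 0 < p -> p < p' ->
  exists m : nat, let x : R := m.+1%:R ^+ 2 in
    L * ((3 * x) `^ r * expR (t * (3 * x) `^ p)) < expR (c * x `^ p').
Proof.
move=> L0 c0 r0 t0 p0 pp'.
pose C := L + r / p + t.
have C0 : 0 <= C by rewrite !addr_ge0// divr_ge0// ltW.
pose d := p' - p.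
have d0 : 0 < d by rewrite subr_gt0.
(* Threshold: [c * x ^ p'] exceeds [C * (3 * x) ^ p] exactly when [x ^ d > Z]. *)
pose Z := C * 3 `^ p / c.
have Z0 : 0 <= Z by rewrite divr_ge0 ?(ltW c0)// mulr_ge0// powR_ge0.
exists (Num.bound (Z `^ d^-1)) => /=.
set m := Num.bound _.
set x : R := m.+1%:R ^+ 2.
have m1 : 1 <= m.+1%:R :> R by rewrite ler1n.
have mx : m.+1%:R <= x by rewrite /x expr2 ler_peMl// (le_trans _ m1).
have x1 : 1 <= x by exact: le_trans mx.
have x0 : 0 < x by exact: lt_le_trans x1.
have y1 : 1 <= (3 * x) `^ p.
  rewrite -[leLHS](powRr0 (3 * x)) ler_powR ?(ltW p0)//; lra.
have y0 : 0 < (3 * x) `^ p by exact: lt_le_trans y1.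
have Zx : Z < x `^ d.
  have -> : Z = (Z `^ d^-1) `^ d by rewrite -powRrM mulVf ?gt_eqF// powRr1.
  apply: gt0_ltr_powR => //; rewrite ?nnegrE ?powR_ge0 ?(ltW x0)//.
  apply: lt_le_trans mx; apply: (lt_le_trans (archi_boundP (powR_ge0 _ _))).
  by rewrite ler_nat.
have polyle : (3 * x) `^ r <= expR (r / p * (3 * x) `^ p).
  have -> : (3 * x) `^ r = ((3 * x) `^ p) `^ (r / p).
    by rewrite -powRrM; congr (_ `^ _); field; rewrite gt_eqF.
  move: ((3 * x) `^ p) y0 => y y0.
  rewrite /powR gt_eqF// ler_expR; apply: ler_wpM2l; first by rewrite divr_ge0// ltW.
  by rewrite -ler_expR lnK ?posrE//; apply: le_trans (expR_ge1Dx _); rewrite lerDr.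
apply: (@le_lt_trans _ _ (expR (C * (3 * x) `^ p))).
  have -> : C * (3 * x) `^ p = L * (3 * x) `^ p + (r / p * (3 * x) `^ p + t * (3 * x) `^ p).
    by rewrite /C; ring.
  rewrite !expRD.
  apply: ler_pM => //; first by rewrite mulr_ge0 ?powR_ge0 ?expR_ge0.
    apply: (@le_trans _ _ (L * (3 * x) `^ p)); first by rewrite ler_peMr.
    by apply: le_trans (expR_ge1Dx _); rewrite lerDr.
  by apply: ler_wpM2r; [exact: expR_ge0|exact: polyle].
rewrite ltr_expR powRM ?(ltW x0)//.
have -> : p' = p + d by rewrite /d; ring.
rewrite powRD; last by rewrite (gt_eqF x0) implybT.
have xp0 : 0 < x `^ p by exact: powR_gt0.
have -> : C * (3 `^ p * x `^ p) = x `^ p * (c * Z) by rewrite /Z; field; rewrite gt_eqF.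
by rewrite [ltRHS]mulrCA ltr_pM2l// ltr_pM2l.
Qed.

Section Couplings.
Variables (R : realType) (Om be et al : R).
Hypotheses (Om0 : 0 < Om) (be0 : 0 < be) (et0 : 0 < et) (al0 : 0 <= al) (al1 : al <= 1).
Let c0 : 0 < be ^+ 2 / et. Proof. by rewrite divr_gt0 ?exprn_gt0. Qed.

Lemma coupling_ge0 (a b n : int) : 0 <= coupling Om be et al a b n.
Proof. by rewrite mulr_ge0 ?powR_ge0 ?M3_ge0. Qed.

(** In [n] the numerator of [M3] is a constant [p], while the denominator is at least
    [4 * Om ^ 2 * |k| ^ 2], which absorbs [|k| ^ al]. No control of [W] in [a, b] is required: in
    the final estimate it only multiplies the quadratic remainder, made small by the choice of
    amplitude. *)
Lemma coupling_le (a b : int) : exists2 W : R, 0 < W &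
  forall n, coupling Om be et al a b n <= W.
Proof.
pose c := be ^+ 2 / et.
pose p : R := c * b%:~R ^+ 2 * (a%:~R ^+ 2 + b%:~R ^+ 2).
have p0 : 0 <= p.
  by apply: mulr_ge0; [apply: mulr_ge0; [exact: (ltW c0)|exact: sqr_ge0]|rewrite addr_ge0 ?sqr_ge0].
have q0 : 0 <= p / (4 * Om ^+ 2) by rewrite divr_ge0// mulr_ge0// sqr_ge0.
exists (p / (4 * Om ^+ 2) + 1); first by rewrite ltr_wpDl.
move=> n; apply: (@le_trans _ _ (p / (4 * Om ^+ 2))); last by rewrite lerDl.
rewrite /coupling /M3; case: ifPn => [_|/= n0]; first by rewrite mulr0.
have D0 := Mden_gt0 be et Om0 (k := (a, b, n)) n0.
rewrite /k1 /k2 /= -/c -/p mulrA ler_pdivrMr//.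
have z1 : 1 <= `|k3 R (a, b, n)| by exact: norm_k3_ge1.
have N1 : 1 <= knorm R (a, b, n) by apply: le_trans z1 (norm_k3_le _ _).
have N2 : knorm R (a, b, n) `^ al <= knorm2 R (a, b, n).
  rewrite -sqr_knorm; apply: (@le_trans _ _ (knorm R (a, b, n))).
    by apply: (le_trans (ler_powR N1 al1)); rewrite powRr1// (le_trans _ N1).
  by rewrite expr2 ler_peMl// (le_trans _ N1).
apply: (@le_trans _ _ (knorm2 R (a, b, n) * p)); first exact: ler_wpM2r.
have -> : knorm2 R (a, b, n) * p = p / (4 * Om ^+ 2) * (4 * Om ^+ 2 * knorm2 R (a, b, n)).
  by field; rewrite gt_eqF.
apply: ler_wpM2l => //; rewrite /Mden.
apply: (@le_trans _ _ (4 * Om ^+ 2 * k3 R (a, b, n) ^+ 2 * knorm2 R (a, b, n))).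
  apply: ler_wpM2r; first exact: knorm2_ge0.
  apply: ler_peMr; first by rewrite mulr_ge0// sqr_ge0.
  rewrite -[k3 R (a, b, n) ^+ 2]real_normK ?num_real//.
  by rewrite exprn_ege1.
by rewrite lerDl mulr_ge0 ?sqr_ge0// exprn_even_ge0.
Qed.

Section Parabola.
Variables (m : nat) (n : int).
Hypotheses (m0 : (0 < m)%N) (n12 : (n == 1) || (n == 2)).
Let k : Z3 := ((m ^ 2)%N%:Z, m%:Z, n).
Let x : R := m%:R ^+ 2.

Let x1 : 1 <= x. Proof. by rewrite exprn_ege1// ler1n. Qed.

Let k1E : k1 R k = x. Proof. by rewrite /k1 /= -pmulrn natrX. Qed.
Let k2E : k2 R k ^+ 2 = x. Proof. by rewrite /k2 /= -pmulrn. Qed.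
Let k3E : 1 <= k3 R k ^+ 2 <= 4.
Proof.
rewrite /k3 /=; case/orP: n12 => /eqP ->.
  by rewrite mulr1z expr1n lexx /= ler1n.
by rewrite -[2 : int]/(2%N%:Z) -pmulrn -natrX ler1n ler_nat.
Qed.

Lemma knorm2_parabola : x ^+ 2 <= knorm2 R k <= 6 * x ^+ 2.
Proof.
rewrite /knorm2 k1E k2E; have /andP[? ?] := k3E.
have : x <= x ^+ 2 by rewrite expr2 ler_peMl// (le_trans _ x1).
by have := x1; move=> ? ?; apply/andP; split; lra.
Qed.

Lemma knorm_parabola : x <= knorm R k <= 3 * x.
Proof.
have /andP[h1 h2] := knorm2_parabola; have x0 : 0 <= x by apply: le_trans x1.
apply/andP; split; rewrite -(ler_pXn2r (n := 2)) ?nnegrE ?knorm_ge0 ?mulr_ge0// sqr_knorm//.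
by apply: (le_trans h2); rewrite (_ : (3 * x) ^+ 2 = 9 * x ^+ 2); [apply: ler_wpM2r; rewrite ?sqr_ge0 ?ler_nat|ring].
Qed.

Lemma Gweight_parabola (r s tau : R) : 0 <= r -> 0 <= 1 / s -> 0 <= tau ->
  Gweight r s tau k <= (3 * x) `^ (2 * r) * expR (2 * tau * (3 * x) `^ (1 / s)).
Proof.
move=> r0 s0 tau0; have /andP[h1 h2] := knorm_parabola.
have x0 : 0 <= 3 * x by apply: le_trans h2; exact: knorm_ge0.
have mono (p : R) : 0 <= p -> knorm R k `^ p <= (3 * x) `^ p.
  by move=> p0; apply: ge0_ler_powR; rewrite ?nnegrE ?knorm_ge0.
rewrite /Gweight; apply: ler_pM; rewrite ?powR_ge0 ?expR_ge0//.
  by apply: mono; rewrite mulr_ge0.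
by rewrite ler_expR; apply: ler_wpM2l; [rewrite mulr_ge0|exact: mono].
Qed.

(** On the parabola [k2 ^ 4 = k1 ^ 2 = x ^ 2], so both terms of the denominator have size [x ^ 2];
    with [n ^ 2 <= 4] and [|k| ^ 2 <= 6 * x ^ 2] it is at most [(96 * Om ^ 2 + c ^ 2) * x ^ 2]. The
    numerator is at least [c * x ^ 3], hence [M3] grows like [x]. *)
Lemma coupling_parabola :
  be ^+ 2 / et / (96 * Om ^+ 2 + (be ^+ 2 / et) ^+ 2) * x `^ (al + 1) <=
  coupling Om be et al (m ^ 2)%N%:Z m%:Z n.
Proof.
have n0 : k.2 != 0 by rewrite /k /=; case/orP: n12 => /eqP ->.
rewrite /coupling /M3 -/k (negPf n0).
have D0 := Mden_gt0 be et Om0 n0.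
have x0 : 0 < x by exact: lt_le_trans x1.
have /andP[N1 _] := knorm_parabola; have /andP[_ N2] := knorm2_parabola.
rewrite powRD; last by rewrite (gt_eqF x0) implybT.
rewrite powRr1 ?(ltW x0)//.
set c := be ^+ 2 / et; have cp : 0 < c := c0.
have E0 : 0 < 96 * Om ^+ 2 + c ^+ 2 by rewrite addr_gt0 ?exprn_gt0// mulr_gt0// exprn_gt0.
have -> : c / (96 * Om ^+ 2 + c ^+ 2) * (x `^ al * x) =
    x `^ al * (c * x / (96 * Om ^+ 2 + c ^+ 2)) by ring.
apply: ler_pM; rewrite ?powR_ge0//; first by rewrite divr_ge0 ?(ltW E0)// mulr_ge0 ?(ltW cp) ?(ltW x0).
  by apply: ge0_ler_powR; rewrite ?nnegrE ?knorm_ge0 ?(ltW x0).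
rewrite ler_pdivrMr// [leRHS]mulrAC ler_pdivlMr// k1E k2E -[leRHS]mulrA -[leLHS]mulrA -[leRHS]mulrA.
rewrite ler_pM2l// ler_pM2l//.
have b4 : k2 R k ^+ 4 = x ^+ 2 by rewrite -k2E -exprM.
rewrite /Mden -/c b4.
have /andP[_ z4] := k3E.
apply: (@le_trans _ _ (4 * Om ^+ 2 * 4 * (6 * x ^+ 2) + c ^+ 2 * x ^+ 2)).
  rewrite lerD2r; apply: ler_pM => //; rewrite ?knorm2_ge0//.
  - by rewrite mulr_ge0 ?sqr_ge0// mulr_ge0 ?sqr_ge0.
  - by apply: ler_wpM2l => //; rewrite mulr_ge0 ?sqr_ge0.
have -> : 4 * Om ^+ 2 * 4 * (6 * x ^+ 2) + c ^+ 2 * x ^+ 2 =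
  x ^+ 2 * (96 * Om ^+ 2 + c ^+ 2) by ring.
by apply: ler_wpM2r; [exact: ltW|rewrite lerDl ltW].
Qed.

End Parabola.
End Couplings.

(** * Continuity in the data norm, and the perturbed initial datum *)

(** One-sided continuity suffices because an orthogonal perturbation can only increase the norm;
    [b >= N] also keeps the point in the quadrant. *)
Lemma continuous_quadrant_right (R : realType) (F : R -> R -> R) (N e : R) :
  {within [set p : R * R | 0 <= p.1 /\ 0 <= p.2], continuous (fun p : R * R => F p.1 p.2)} ->
  0 <= N -> 0 < e ->
  exists2 d : R, 0 < d & forall b, N <= b < N + d -> `|F N b - F N N| < e.
Proof.
move=> /subspace_continuousP cF N0 e0.
have /(_ (conj N0 N0)) := cF (N, N).
move=> /cvgrPdist_lt /(_ e e0); rewrite near_withinE => /nbhs_ballP[d /= d0 dF].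
exists d => // b /andP[Nb bd]; rewrite distrC; apply: (dF (N, b)).
  split => /=; first exact: ballxx.
  by rewrite /ball /= distrC ger0_norm ?subr_ge0// ltrBlDl.
by split => //=; exact: le_trans Nb.
Qed.

Section Perturbation.
Variable (R : realType) (m : nat).

Definition mode (n : int) : Z3 := ((m.+1 ^ 2)%N%:Z, m.+1%:Z, n).

(** The reflected modes make the function real-valued. The coefficients are real, hence orthogonal
    to the imaginary ones of [steady]. *)
Definition bump (k : Z3) : R :=
  [|| k == mode 1, k == mode 2, zneg k == mode 1 | zneg k == mode 2]%:R.

Lemma zneg_involutive : involutive zneg.
Proof. by case=> [[x y] z]; rewrite /zneg /= !opprK. Qed.

Lemma bump_zneg k : bump (zneg k) = bump k.
Proof. by rewrite /bump zneg_involutive; do 4!case: (_ == _). Qed.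

Lemma bump0 : bump (0, 0, 0)%R = 0.
Proof. by []. Qed.

(** The second coordinate is positive on modes and negative on reflected ones, so the four excited
    modes are distinct and the chain over [n] sees only [n = 1, 2]. *)
Lemma zneg_mode_neq n n' : (zneg (mode n) == mode n') = false.
Proof. by apply/eqP => /(congr1 (fun k : Z3 => k.1.2)). Qed.

Lemma bump_mode n : bump (mode n) = ((n == 1) || (n == 2))%:R.
Proof. by rewrite /bump !zneg_mode_neq /mode !xpair_eqE !eqxx /= !orbF. Qed.

Definition perturbation (e : R) (k : Z3) : R[i] := Complex (e * bump k) 0.

Lemma wnorm2_perturbation (w : Z3 -> R) (e : R) :
  (forall k, 0 <= w k) -> (forall k, w (zneg k) = w k) ->
  wnorm2 w (perturbation e) = (e ^+ 2 * (2 * (w (mode 1) + w (mode 2))))%:E.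
Proof.
move=> w0 wN; pose s := [:: mode 1; mode 2; zneg (mode 1); zneg (mode 2)].
rewrite (@wnorm2_finite_support _ _ _ s)//.
- congr (_%:E); rewrite !big_cons big_nil !wN /perturbation !bump_zneg !bump_mode /cnorm2 /=.
  by ring.
- have ne n n' : (mode n == zneg (mode n')) = false by rewrite eq_sym zneg_mode_neq.
  by rewrite /s /= !inE !ne (inj_eq (inv_inj zneg_involutive)) /mode !xpair_eqE !eqxx.
- by rewrite /perturbation bump0 mulr0.
- move=> k; rewrite !inE !negb_or => /and4P[k1 k2 k3 k4].
  rewrite /perturbation /bump -!(inv_eq zneg_involutive) in k3 k4 *.
  by rewrite (negPf k1) (negPf k2) (negPf k3) (negPf k4) mulr0.
Qed.

End Perturbation.

Lemma Gweight_ge0 (R : realType) (r s tau : R) k : 0 <= Gweight r s tau k.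
Proof. by rewrite mulr_ge0 ?powR_ge0 ?expR_ge0. Qed.

Lemma Gweight_zneg (R : realType) (r s tau : R) k : Gweight r s tau (zneg k) = Gweight r s tau k.
Proof.
by rewrite /Gweight /knorm /knorm2 /k1 /k2 /k3 /zneg /= !mulrNz !sqrrN.
Qed.

Lemma Re_steady (R : realType) k : complex.Re (steady R k) = 0.
Proof. by rewrite /steady; case: ifP => //; case: ifP. Qed.

Lemma cnorm2_steadyD (R : realType) m (e : R) k :
  cnorm2 (steady R k + perturbation m e k) = cnorm2 (steady R k) + cnorm2 (perturbation m e k).
Proof.
have := Re_steady R k; rewrite /perturbation /cnorm2.
by case: (steady R k) => a b /= ->; ring.
Qed.

Lemma perturbed_in_space (R : realType) (w : Z3 -> R) m (e : R) :
  (forall k, 0 <= w k) -> (forall k, w (zneg k) = w k) ->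
  in_space w (fun k => steady R k + perturbation m e k).
Proof.
move=> w0 wN; have [st0 stN stoo] := steady_in_space w0.
have p0 : perturbation m e (0, 0, 0)%R = 0 by rewrite /perturbation bump0 mulr0.
split.
- by rewrite st0 p0 addr0.
- by move=> k; rewrite stN rmorphD /perturbation bump_zneg /= oppr0.
- rewrite (wnorm2_orthogonal w0 st0 p0); [|by rewrite st0 p0 addr0|exact: cnorm2_steadyD].
  by rewrite wnorm2_perturbation// lte_add_pinfty// ltry.
Qed.

Lemma sqr_Re_mode_le (R : realType) (q B : R) (ps : Z3 -> R[i]) k : 0 <= q -> 0 <= B ->
  k != (0, 0, 0)%R -> (wnorm2 (Hweight q) ps < +oo)%E -> wnorm (Hweight q) ps <= B ->
  `|complex.Re (ps k)| <= B.
Proof.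
move=> q0 B0 k0 foo hB; rewrite -(ler_pXn2r (n := 2)) ?nnegrE// real_normK ?num_real//.
have n0 : 0 <= wnorm (Hweight q) ps by exact: sqrtr_ge0.
apply: (@le_trans _ _ (wnorm (Hweight q) ps ^+ 2)); last by rewrite ler_pXn2r ?nnegrE.
apply: le_trans (wnorm2_mode (@Hweight_ge0 _ q) foo k0).
apply: (@le_trans _ _ (cnorm2 (ps k))); first by rewrite /cnorm2 lerDl sqr_ge0.
apply: ler_peMl; first exact: cnorm2_ge0.
by rewrite /Hweight -[leLHS](powRr0 (knorm R k)) ler_powR ?knorm_ge1// mulr_ge0.
Qed.

(** * Growth of the perturbation along the chain of modes *)

Section PerturbedGrowth.
Variables (R : realType) (Om be et al q : R) (m : nat) (T e lam W B : R).
Variables (th2 : R -> Z3 -> R[i]) (T0 : R).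
Hypotheses (Om0 : 0 < Om) (be0 : 0 < be) (et0 : 0 < et) (al0 : 0 <= al) (alq : al + 1 <= q).
Hypotheses (T_ge0 : 0 <= T) (TT0 : T <= T0) (e0 : 0 <= e) (W0 : 0 < W) (B0 : 0 <= B).
Let a : int := (m.+1 ^ 2)%N%:Z.
Let b : int := m.+1%:Z.
Let w := coupling Om be et al a b.
Hypotheses (wW : forall n, w n <= W) (lam1 : 2 * lam <= w 1) (lam2 : 2 * lam <= w 2).
Hypothesis sol : is_sol al Om be et (Hweight q) T0 (fun k => steady R k + perturbation m e k) th2.
Let ps t k := th2 t k - steady R k.
Hypothesis psB : forall t, 0 <= t <= T -> wnorm (Hweight q) (ps t) <= B.

(** [linear_growth] is applied to the real parts of [ps] on the chain [(a, b, n)], with [delta] the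
    quadratic remainder; mode 1 at time [T] is in turn at most [B]. *)
Lemma perturbation_growth :
  e * expR (lam * T) - 2 * (3 / Om * B ^+ 2) * T * expR (2 * W * T) <= B.
Proof.
have q0 : 0 <= q by apply: le_trans alq; rewrite addr_ge0.
have w_ge0 n : 0 <= w n by exact: coupling_ge0.
have tT0 t : 0 <= t <= T -> 0 <= t <= T0.
  by move=> /andP[-> tT] /=; exact: le_trans TT0.
have [st0 stN stoo] := steady_in_space (@Hweight_ge0 _ q).
have [inX _ eqn] := sol.
have ps0 t : 0 <= t <= T -> ps t (0, 0, 0)%R = 0.
  by move=> /tT0 /inX[th0 _ _]; rewrite /ps th0 st0 subrr.
have psoo t : 0 <= t <= T -> (wnorm2 (Hweight q) (ps t) < +oo)%E.
  by move=> /tT0 /inX[th0 _ thoo]; apply: wnorm2B_fin => //; exact: Hweight_ge0.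
have psB2 t : 0 <= t <= T -> (wnorm2 (Hweight q) (ps t) <= (B ^+ 2)%:E)%E.
  move=> tT; rewrite wnorm2_fine ?psoo//; last exact: Hweight_ge0.
  by rewrite lee_fin ler_pXn2r ?nnegrE ?sqrtr_ge0// psB.
(* Modes 1 and 2 feed each other, each with coupling at least [2 * lam]; this makes [c] a
   sub-eigenvector, which a single excited mode would not be. *)
pose c (n : int) : R := e * ((n == 1) || (n == 2))%:R.
pose f (n : int) t := complex.Re (ps t (a, b, n)).
pose h (n : int) t := complex.Re (nl al Om be et (th2 t) (a, b, n)).
have fB n t : 0 <= t <= T -> `|f n t| <= B.
  by move=> tT; apply: (sqr_Re_mode_le q0 B0 _ (psoo _ tT)) => //; exact: psB.
have c0 n : 0 <= c n by rewrite mulr_ge0.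
have c1 : c 1 = e by rewrite /c eqxx mulr1.
have c2 : c 2 = e by rewrite /c eqxx orbT mulr1.
have cle n : c n <= e by rewrite /c; case: (_ || _); rewrite ?mulr1 ?mulr0.
have growth n : c n * expR (lam * T) - 2 * (3 / Om * B ^+ 2) * T * expR (2 * W * T) <= f n T.
  (* The last argument is the crude bound that starts the iteration: [B] controls [f], the other
     summand controls the subsolution. *)
  apply: (@linear_growth _ f h w c T (3 / Om * B ^+ 2) lam W _ _ _ _ _ _ _ _ _
     (B + e * expR (`|lam| * T))) => //.
  - by rewrite mulr_ge0 ?sqr_ge0// divr_ge0// ltW.
  - by move=> k; rewrite w_ge0 wW.
  - move=> k; have cw0 i j : 0 <= w i * c j by rewrite mulr_ge0.
    have [->|k1] := eqVneq k 1.
      rewrite (_ : 1 + 1 = 2 :> int)// c1 c2.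
      apply: (@le_trans _ _ (w 2 * e)); first by rewrite ler_wpM2r.
      by rewrite lerDr; exact: cw0.
    have [->|k2] := eqVneq k 2.
      rewrite (_ : 2 - 1 = 1 :> int)// c1 c2.
      apply: (@le_trans _ _ (w 1 * e)); first by rewrite ler_wpM2r.
      by rewrite lerDl; exact: cw0.
    by rewrite {1}/c (negPf k1) (negPf k2) mulr0 mulr0 addr_ge0.
  - by move=> n' t /tT0 tT; have [_ ih _ _] := eqn t (a, b, n') tT.
  - move=> n' t tT; have [_ _ _ thE] := eqn t (a, b, n') (tT0 _ tT).
    rewrite /f /ps thE; have := Re_steady R (a, b, n').
    rewrite /perturbation (bump_mode R m n'); rewrite /h /c.
    by case: (steady R (a, b, n')) => x y /= ->; ring.
  - move=> n' u uT; apply: (@Re_nl_le _ _ _ _ _ Om0 be0 et0 al0 q _ _ (ps u)) => //.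
    + exact: ps0.
    + by move=> k; rewrite /ps addrCA subrr addr0.
    + exact: psB2.
    + by have [+ _ _ _] := eqn u (a, b, n') (tT0 _ uT); apply; move/andP: uT => [-> _] /=.
  - move=> n' t tT; have := fB n' t tT; rewrite ler_norml => /andP[h1 _].
    apply: le_trans h1; rewrite lerN2 lerDl mulr_ge0// expR_ge0.
  - by move=> n'; rewrite ler_wpDl// ler_wpM2r ?expR_ge0.
have := growth 1; rewrite c1 => /le_trans; apply.
by apply: le_trans (ler_norm _) _; apply: fB; rewrite T_ge0 lexx.
Qed.

End PerturbedGrowth.

(** * Contradiction with the Lipschitz bound *)

Theorem theorem5p2 (R : realType) (Om be et r al q s : R) :
  0 < Om -> 0 < be -> 0 < et -> 3 < r ->
  0 <= al <= 1 -> al + 7 / 4 < q -> 1 / (al + 1) < s ->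
  forall tau : R, 0 < tau ->
    ~ loc_lip_wp al Om be et (Hweight q) (Gweight r s tau).
Proof.
move=> Om0 be0 et0 r3 /andP[al0 al1] alq als tau tau0 [T [K [cT cK TK0 wp]]].
have s0 : 0 < s by apply: le_lt_trans als; rewrite divr_ge0// addr_ge0.
have p0 : 0 < 1 / s by rewrite divr_gt0.
have sal : 1 / s < al + 1.
  by move: als; rewrite !ltr_pdivrMr// ?ltr_pwDr// mulrC.
have alq1 : al + 1 <= q by lra.
have Gge0 := @Gweight_ge0 R r s tau; have GN := @Gweight_zneg R r s tau.
have inY := steady_in_space Gge0.
pose N := wnorm (Gweight r s tau) (steady R).
have N0 : 0 <= N by exact: sqrtr_ge0.
have [T00 K00] := TK0 N N N0 N0.
(* Halving the time and doubling the constant at [(N, N)] gives values valid for all data norms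
   slightly above [N], fixed before frequency and amplitude are chosen. *)
pose T1 := T N N / 2; pose K1 := 2 * K N N.
have T10 : 0 < T1 by rewrite divr_gt0.
have K10 : 0 < K1 by rewrite mulr_gt0.
have [d1 d10 dT] := continuous_quadrant_right cT N0 T10.
have [d2 d20 dK] := continuous_quadrant_right cK N0 K00.
pose kappa := be ^+ 2 / et / (96 * Om ^+ 2 + (be ^+ 2 / et) ^+ 2).
have c0 : 0 < be ^+ 2 / et by rewrite divr_gt0// exprn_gt0.
have kappa0 : 0 < kappa.
  by rewrite divr_gt0// addr_gt0// ?exprn_gt0// mulr_gt0// exprn_gt0.
(* This is the square of the inequality [K1 * Y < expR (lam * T1)] below, whence the factor 4 from
   [Y ^ 2 = 4 * G] and the rate [kappa * T1] from [2 * lam * T1]. *)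
have [m /=] := @polynomial_exp_lt_exp R (4 * K1 ^+ 2) (kappa * T1) (2 * r) (2 * tau) (1 / s) (al + 1)
  ltac:(by rewrite mulr_ge0 ?sqr_ge0) ltac:(by rewrite mulr_gt0) ltac:(lra) ltac:(lra) p0 sal.
pose x : R := m.+1%:R ^+ 2.
rewrite -/x; set G := _ `^ _ * expR _ => Glt.
pose lam := kappa * x `^ (al + 1) / 2.
pose a : int := (m.+1 ^ 2)%N%:Z; pose b : int := m.+1%:Z.
pose w := coupling Om be et al a b.
have wn n : (n == 1) || (n == 2) -> 2 * lam <= w n.
  move=> n12; have := coupling_parabola Om0 be0 et0 al0 (ltn0Sn m) n12.
  by rewrite (_ : 2 * lam = kappa * x `^ (al + 1)) // /lam; field.
have [W W0 wW] := coupling_le Om0 be0 et0 al1 a b.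
(* [Y] bounds the Gevrey norm of the perturbation per unit amplitude: four modes, each of weight at
   most [G]. *)
pose Y := Num.sqrt (4 * G).
have G0 : 0 <= G by rewrite mulr_ge0 ?powR_ge0 ?expR_ge0.
have Y0 : 0 <= Y by exact: sqrtr_ge0.
have Y2 : Y ^+ 2 = 4 * G by rewrite sqr_sqrtr// mulr_ge0.
have KY0 : 0 <= K1 * Y by exact: mulr_ge0 (ltW K10) Y0.
have KY : K1 * Y < expR (lam * T1).
  rewrite -(ltr_pXn2r (n := 2)) ?nnegrE ?expR_ge0//.
  rewrite exprMn Y2 -expRM_natl.
  have -> : K1 ^+ 2 * (4 * G) = 4 * K1 ^+ 2 * G by ring.
  have -> : 2%:R * (lam * T1) = kappa * T1 * x `^ (al + 1) by rewrite /lam; field.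
  exact: Glt.
(* The quadratic remainder at unit amplitude; at amplitude [e] it is [e ^ 2 * D]. *)
pose D := 2 * (3 / Om * (K1 * Y) ^+ 2) * T1 * expR (2 * W * T1).
have D0 : 0 <= D.
  have E0 : 0 <= 3 / Om * (K1 * Y) ^+ 2 by rewrite mulr_ge0 ?sqr_ge0// divr_ge0// ltW.
  by apply: mulr_ge0; [apply: mulr_ge0; [exact: mulr_ge0|exact: ltW]|exact: expR_ge0].
have [e e0 [eY1 eY2 eD]] : exists2 e : R, 0 < e &
    [/\ e * Y < d1, e * Y < d2 & e * D < expR (lam * T1) - K1 * Y].
  (* The shift [u + 1] keeps the quotient meaningful when [u = 0]. *)
  have sm (u v : R) : 0 <= u -> 0 < v -> forall e, 0 < e -> e <= v / (u + 1) -> e * u < v.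
    move=> u0 v0 e e0; rewrite ler_pdivlMr ?ltr_wpDl// => h; apply: lt_le_trans h.
    by rewrite ltr_pM2l// ltrDl.
  pose e1 := d1 / (Y + 1); pose e2 := d2 / (Y + 1).
  pose e3 := (expR (lam * T1) - K1 * Y) / (D + 1).
  have e10 : 0 < e1 by rewrite divr_gt0// ltr_wpDl.
  have e20 : 0 < e2 by rewrite divr_gt0// ltr_wpDl.
  have e30 : 0 < e3 by apply: divr_gt0; [rewrite subr_gt0|rewrite ltr_wpDl].
  have mpos : 0 < Num.min e1 (Num.min e2 e3) by rewrite !lt_min e10 e20.
  exists (Num.min e1 (Num.min e2 e3)) => //; split; apply: sm => //.
  - by rewrite ge_min lexx.
  - by rewrite !ge_min lexx orbT.
  - by rewrite subr_gt0.
  - by rewrite !ge_min lexx !orbT.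
pose th02 k := steady R k + perturbation m e k.
have inY2 : in_space (Gweight r s tau) th02 by exact: perturbed_in_space.
have GG n : (n == 1) || (n == 2) -> Gweight r s tau (mode m n) <= G.
  move=> n12; apply: Gweight_parabola => //; [lra|exact: ltW|exact: ltW].
have pert2 : (wnorm2 (Gweight r s tau) (perturbation m e) <= ((e * Y) ^+ 2)%:E)%E.
  rewrite wnorm2_perturbation// lee_fin exprMn Y2; apply: ler_wpM2l; first exact: sqr_ge0.
  rewrite (_ : 4 * G = 2 * (G + G)); last by ring.
  by apply: ler_wpM2l => //; apply: lerD; apply: GG.
have eY0 : 0 <= e * Y by rewrite mulr_ge0// ltW.
pose N2 := wnorm (Gweight r s tau) th02.
have N2E : [/\ N <= N2 & N2 <= N + e * Y].
  have [st0 _ stoo] := inY; have [t0 _ too] := inY2.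
  have p00 : perturbation m e (0, 0, 0)%R = 0 by rewrite /perturbation bump0 mulr0.
  have := wnorm2_orthogonal Gge0 st0 p00 t0 (cnorm2_steadyD m e).
  rewrite (wnorm2_fine Gge0 too) (wnorm2_fine Gge0 stoo).
  have poo : (wnorm2 (Gweight r s tau) (perturbation m e) < +oo)%E.
    by apply: le_lt_trans pert2 _; rewrite ltry.
  move: pert2; rewrite (wnorm2_fine Gge0 poo) lee_fin -EFinD => pe [].
  rewrite -/N -/N2 => NE; split; rewrite -(ler_pXn2r (n := 2)) ?nnegrE ?sqrtr_ge0 ?addr_ge0//.
    by rewrite NE lerDl sqr_ge0.
  rewrite NE sqrrD; have : 0 <= N * (e * Y) by rewrite mulr_ge0.
  by rewrite mulr2n -addrA lerD2l => NeY; apply: (le_trans pe); rewrite lerDr addr_ge0.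
have [NN2 N2N] := N2E.
have T1le : T1 <= T N N2.
  have := dT N2; rewrite NN2 (le_lt_trans N2N) ?ltrD2l//= => /(_ isT).
  by rewrite ltr_norml /T1 => /andP[+ _]; clear; lra.
have K1le : K N N2 <= K1.
  have := dK N2; rewrite NN2 (le_lt_trans N2N) ?ltrD2l//= => /(_ isT).
  by rewrite ltr_norml /K1 => /andP[_]; clear; lra.
have [th1 [th2 [sol1 sol2 uniq1 _ lip]]] := wp _ _ inY inY2.
have T1in t : 0 <= t <= T1 -> 0 <= t <= T N N2.
  by move=> /andP[-> tT] /=; exact: le_trans T1le.
(* Uniqueness identifies the solution issued from [steady] with the stationary one. *)
have th1E t : 0 <= t <= T1 -> th1 t = steady R.
  by move=> /T1in tT; rewrite -(uniq1 _ (steady_is_sol _ _ _ _ _ (@Hweight_ge0 _ q)) t tT).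
have cnorm2N (z : R[i]) : cnorm2 (- z) = cnorm2 z by case: z => u v; rewrite /cnorm2 /= !sqrrN.
have wnormN (v : Z3 -> R) (f g : Z3 -> R[i]) : (forall k, f k = - g k) -> wnorm v f = wnorm v g.
  by move=> fg; congr (Num.sqrt (fine _)); apply: eq_esum => k _; rewrite fg cnorm2N.
have psB t : 0 <= t <= T1 -> wnorm (Hweight q) (fun k => th2 t k - steady R k) <= K1 * (e * Y).
  move=> tT; have := lip t (T1in t tT); rewrite (th1E t tT).
  rewrite (wnormN _ _ (fun k => th2 t k - steady R k)); last by move=> k; rewrite opprB.
  move=> /le_trans; apply.
  rewrite -/N -/N2 (wnormN _ _ (perturbation m e)); last first.
    by move=> k; rewrite /th02 opprD addNKr.
  apply: ler_pM => //; rewrite ?sqrtr_ge0//; first by have [_ /ltW] := TK0 N N2 N0 (le_trans N0 NN2).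
  rewrite -(ler_pXn2r (n := 2)) ?nnegrE ?sqrtr_ge0// -lee_fin -wnorm2_fine//.
  by apply: le_lt_trans pert2 _; rewrite ltry.
have B0 : 0 <= K1 * (e * Y) by exact: mulr_ge0 (ltW K10) eY0.
have := @perturbation_growth R Om be et al q m T1 e lam W _ th2 _ Om0 be0 et0 al0 alq1 (ltW T10)
  T1le (ltW e0) W0 B0 wW (wn 1 isT) (wn 2 isT) sol2 psB.
have -> : 2 * (3 / Om * (K1 * (e * Y)) ^+ 2) * T1 * expR (2 * W * T1) = e * (e * D).
  by rewrite /D; ring.
have -> : K1 * (e * Y) = e * (K1 * Y) by ring.
(* Dividing by [e] leaves [expR (lam * T1) - e * D <= K1 * Y], against the choice of [e]. *)
rewrite -mulrBr ler_pM2l//; move: eD; clear; lra.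
Qed.
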